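(* Let $\mathcal{K}_G$ be the Green's operator of the anti-periodic problem on $[0,1]$ (boundary conditions $u(0)=-u(1)$, $u'(0)=-u'(1)$). Then $\mathcal{K}_G$ is a rank $1$ perturbation of $\mathcal{K}$, i.e. $\mathcal{T}=\mathcal{K}-\mathcal{K}_G$ has rank $1$. Moreover, with $u_1\equiv1$, for all $f\in L^2(0,1)$, $$\mathcal{T}f(x)=-\tfrac14\langle f,u_1\rangle u_1(x)=-\tfrac14\int_0^1f(y)\,dy.$$
   Context: $\langle f,g\rangle=\int_0^1f(x)g(x)\,dx$. $\mathcal{K}$ is the integral operator on $L^2(0,1)$ given by $\mathcal{K}f(x)=-\frac12\int_0^1|x-y|\,f(y)\,dy$. $A$ denotes the self-adjoint operator $-\frac{d^2}{dx^2}$ on $L^2(0,1)$ with domain the functions in $H^2(0,1)$ satisfying the stated boundary conditions. $P$ denotes the orthogonal projection onto $\ker A$ (here $P=0$). The Green's operator $\mathcal{K}_G$ is the bounded operator $S$ on $L^2(0,1)$ determined by $AS=I-P$ and $SP=PS=0$ (so here $\mathcal{K}_G=A^{-1}$); it is an integral operator, $\mathcal{K}_Gf(x)=\int_0^1G_0(x,y)f(y)\,dy$, with $G_0$ the Green's function. *)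

(* Defs.v *)
From HB Require Import structures.
From mathcomp Require Import all_boot all_order all_algebra.
From mathcomp Require Import all_classical all_reals all_analysis.
From mathcomp Require Import measurable_realfun ess_sup_inf.

Set Implicit Arguments.
Unset Strict Implicit.
Unset Printing Implicit Defensive.

Import Order.TTheory GRing.Theory Num.Theory.
Import numFieldNormedType.Exports.

Local Open Scope classical_set_scope.
Local Open Scope ring_scope.

Section Lspace_lmodule.
Context d (T : measurableType d) (R : realType).
Variables (mu : {measure set T -> \bar R}) (p : \bar R) (p1 : (1 <= p)%E).
Local Notation Lfn := (LfunType mu p1).
Local Notation Lsp := (LspaceType mu p1).

Local Open Scope quotient_scope.

Lemma finite_norm_ae_eq (f g : T -> R) :
  measurable_fun setT f -> measurable_fun setT g ->
  (f : T -> R) = g %[ae mu] -> finite_norm mu p f -> finite_norm mu p g.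
Proof.
rewrite /finite_norm => mf mg fg; suff -> : ('N[mu]_p[EFin \o f] = 'N[mu]_p[EFin \o g])%E by [].
rewrite unlock /Lnorm; case: p p1 => [r r1| _|//].
- have mP (h : T -> R) : measurable_fun setT h ->
    measurable_fun setT (fun x => (`|(EFin \o h) x| `^ r)%E : \bar R).
    move=> mh; apply: (@measurableT_comp _ _ _ _ _ _ (fun y : \bar R => y `^ r)%E).
      exact: measurable_poweR.
    by apply: measurableT_comp => //; exact/measurable_EFinP.
  congr (_ `^ _)%E; apply: ge0_ae_eq_integral => //; do ?exact: mP.
  + by move=> x _; exact: poweR_ge0.
  + by move=> x _; exact: poweR_ge0.
  + by move: fg; apply: filterS => x /= + _ => /(_ I) ->.
- case: ifPn => // _; apply: eq_ess_sup.
  by move: fg; apply: filterS => x /= /(_ I) ->.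
Qed.

Lemma ae_app (P Q : T -> Prop) : (\forall x \ae mu, P x) ->
  (\forall x \ae mu, P x -> Q x) -> \forall x \ae mu, Q x.
Proof. by apply: filterS2 => x Px; apply. Qed.

(* [LspaceType] is a quotient of [{mfun T >-> measurableTypeR R}], whereas
   [LfunType] consists of elements of [{mfun T >-> R}]: the two measurable
   structures have the same measurable sets but different displays. *)
Lemma measurable_fun_measurableTypeR (f : T -> R) :
  measurable_fun setT f -> @measurable_fun _ _ T (measurableTypeR R) setT f.
Proof. by []. Qed.

Definition mfun_measurableTypeR (f : Lfn) : {mfun T >-> measurableTypeR R} :=
  HB.pack_for {mfun T >-> measurableTypeR R} (f : T -> measurableTypeR R)
    (isMeasurableFun.Build _ _ _ _ (f : T -> measurableTypeR R)
      (measurable_fun_measurableTypeR (@measurable_funPT _ _ _ _ f))).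

Definition pi_Lspace (f : Lfn) : aeEqMfun (measurableTypeR R) mu :=
  \pi_(aeEqMfun (measurableTypeR R) mu) (mfun_measurableTypeR f).

Lemma ae_eq_pi_Lspace (f : Lfn) : (f : T -> R) = pi_Lspace f %[ae mu].
Proof.
have /eqmodP/asboolP := reprK (pi_Lspace f).
exact: ae_eq_sym.
Qed.

Lemma Lclass_subproof (f : Lfn) : finite_norm mu p (pi_Lspace f).
Proof.
apply: (finite_norm_ae_eq _ _ (ae_eq_pi_Lspace f)).
- exact: measurable_funPT.
- exact: (@measurable_funPT _ _ _ _ (repr (pi_Lspace f))).
- exact: Lfunction_finite.
Qed.

Definition Lclass (f : Lfn) : Lsp :=
  HB.pack_for Lsp (pi_Lspace f)
    (isFinLebesgue.Build _ _ _ _ _ p1 _ (Lclass_subproof f)).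

Lemma Lrepr_subproof (u : Lsp) : (u : T -> R) \in Lfun mu p.
Proof.
apply/andP; split; rewrite inE/=; first exact: (@measurable_funPT _ _ _ _ (repr (u : aeEqMfun _ mu))).
exact: Lebesgue_finite.
Qed.

Definition Lrepr (u : Lsp) : Lfn := Lfun_Sub p1 (Lrepr_subproof u).
Lemma LreprE (u : Lsp) : Lrepr u = u :> (T -> R). Proof. by []. Qed.

Lemma Lclass_ae (f : Lfn) : (Lclass f : T -> R) = f %[ae mu].
Proof. exact/ae_eq_sym/ae_eq_pi_Lspace. Qed.

Lemma Lspace_eqP (u v : Lsp) : u = v <-> (u : T -> R) = v %[ae mu].
Proof.
split=> [->|uv]; first exact: ae_eq_refl.
have : (u : aeEqMfun _ mu) = v.
  by rewrite -[u : aeEqMfun _ mu]reprK -[v : aeEqMfun _ mu]reprK; apply/eqmodP/asboolP.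
case: u v {uv} => [u [[mu_]]] [v [[mv]]] /= uv.
by rewrite uv in mu_ *; congr LebesgueSpace.Pack;
  do 2!congr LebesgueSpace.Class; congr isFinLebesgue.Axioms_; exact: bool_irrelevance.
Qed.

Definition Lzero : Lsp := Lclass 0.
Definition Lopp (u : Lsp) : Lsp := Lclass (- Lrepr u).
Definition Ladd (u v : Lsp) : Lsp := Lclass (Lrepr u + Lrepr v).
Definition Lscale (a : R) (u : Lsp) : Lsp := Lclass (a *: Lrepr u).

Lemma Lzero_ae : \forall x \ae mu, Lzero x = 0.
Proof. by have := Lclass_ae 0; apply: filterS => x; exact. Qed.

Lemma Lopp_ae u : \forall x \ae mu, Lopp u x = - u x.
Proof. by have := Lclass_ae (- Lrepr u); apply: filterS => x; exact. Qed.

Lemma Ladd_ae u v : \forall x \ae mu, Ladd u v x = u x + v x.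
Proof. by have := Lclass_ae (Lrepr u + Lrepr v); apply: filterS => x; exact. Qed.

Lemma Lscale_ae a u : \forall x \ae mu, Lscale a u x = a * u x.
Proof. by have := Lclass_ae (a *: Lrepr u); apply: filterS => x; exact. Qed.

HB.instance Definition _ := gen_eqMixin Lsp.
HB.instance Definition _ := gen_choiceMixin Lsp.

Let LaddA : associative Ladd.
Proof.
move=> u v w; apply/Lspace_eqP.
apply: (ae_app (Ladd_ae u (Ladd v w))); apply: (ae_app (Ladd_ae v w)).
apply: (ae_app (Ladd_ae (Ladd u v) w)); apply: (ae_app (Ladd_ae u v)).
by apply: aeW => x h1 h2 h3 h4 _; rewrite h4 h3 h2 h1 addrA.
Qed.

Let LaddC : commutative Ladd.
Proof. by move=> u v; rewrite /Ladd addrC. Qed.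

Let Ladd0 : left_id Lzero Ladd.
Proof.
move=> u; apply/Lspace_eqP.
apply: (ae_app (Ladd_ae Lzero u)); apply: (ae_app Lzero_ae).
by apply: aeW => x h1 h2 _; rewrite h2 h1 add0r.
Qed.

Let LaddN : left_inverse Lzero Lopp Ladd.
Proof.
move=> u; apply/Lspace_eqP; apply: (ae_app (Ladd_ae (Lopp u) u)).
apply: (ae_app (Lopp_ae u)); apply: (ae_app Lzero_ae).
by apply: aeW => x h1 h2 h3 _; rewrite h3 h2 h1 addNr.
Qed.

HB.instance Definition _ := GRing.isZmodule.Build Lsp LaddA LaddC Ladd0 LaddN.

Let LscaleA a b u : Lscale a (Lscale b u) = Lscale (a * b) u.
Proof.
apply/Lspace_eqP; apply: (ae_app (Lscale_ae a (Lscale b u))).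
apply: (ae_app (Lscale_ae b u)); apply: (ae_app (Lscale_ae (a * b) u)).
by apply: aeW => x h1 h2 h3 _; rewrite h3 h2 h1 mulrA.
Qed.

Let Lscale1 : left_id 1 Lscale.
Proof.
move=> u; apply/Lspace_eqP; apply: (ae_app (Lscale_ae 1 u)).
by apply: aeW => x h _; rewrite h mul1r.
Qed.

Let LscaleDr : right_distributive Lscale +%R.
Proof.
move=> a u v; apply/Lspace_eqP.
apply: (ae_app (Lscale_ae a (Ladd u v))); apply: (ae_app (Ladd_ae u v)).
apply: (ae_app (Ladd_ae (Lscale a u) (Lscale a v))).
apply: (ae_app (Lscale_ae a u)); apply: (ae_app (Lscale_ae a v)).
by apply: aeW => x h1 h2 h3 h4 h5 _; rewrite h5 h4 h3 h2 h1 mulrDr.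
Qed.

Let LscaleDl u : {morph Lscale^~ u : a b / a + b}.
Proof.
move=> a b; apply/Lspace_eqP; apply: (ae_app (Lscale_ae (a + b) u)).
apply: (ae_app (Ladd_ae (Lscale a u) (Lscale b u))).
apply: (ae_app (Lscale_ae a u)); apply: (ae_app (Lscale_ae b u)).
by apply: aeW => x h1 h2 h3 h4 _; rewrite h4 h3 h2 h1 mulrDl.
Qed.

HB.instance Definition _ :=
  GRing.Zmodule_isLmodule.Build R Lsp LscaleA Lscale1 LscaleDr LscaleDl.

Lemma Lspace0E : \forall x \ae mu, (0 : Lsp) x = 0.
Proof. exact: Lzero_ae. Qed.

Lemma LspaceNE (u : Lsp) : \forall x \ae mu, (- u : Lsp) x = - u x.
Proof. exact: Lopp_ae. Qed.

Lemma LspaceDE (u v : Lsp) : \forall x \ae mu, (u + v : Lsp) x = u x + v x.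
Proof. exact: Ladd_ae. Qed.

Lemma LspaceZE a (u : Lsp) : \forall x \ae mu, (a *: u : Lsp) x = a * u x.
Proof. exact: Lscale_ae. Qed.

End Lspace_lmodule.

Section restricted_integral.
Context d (T : measurableType d) (R : realType).
Variables (mu : {measure set T -> \bar R}) (D : set T) (mD : measurable D).

Lemma ge0_integral_mrestr (f : T -> \bar R) : measurable_fun setT f ->
  (forall x, 0 <= f x)%E ->
  (\int[mrestr mu mD]_x f x = \int[mu]_(x in D) f x)%E.
Proof.
move=> mf f0; have mDc := measurableC mD.
have mfD E : measurable_fun E f by exact: measurable_funTS.
have r0 : mrestr mu mD (~` D) = 0%E by rewrite /mrestr setICl measure0.
have r0' : mrestr mu mDc D = 0%E by rewrite /mrestr setICr measure0.
have -> : (\int[mrestr mu mD]_x f x = \int[mrestr mu mD]_(x in D) f x)%E.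
  rewrite -(setUv D) ge0_integral_setU ?setUv//.
    by rewrite [X in (_ + X)%E]null_set_integral// adde0.
  by rewrite disj_set2E setICr.
rewrite -[LHS]adde0 -(@null_set_integral _ _ _ (mrestr mu mDc) D f)//.
rewrite -ge0_integral_measure_add//.
apply: eq_measure_integral => A mA AD.
rewrite -[LHS]/(measure_add _ _ A) measure_addE /= /mrestr -measureU//; try exact: measurableI.
  by rewrite -setIUr setUv setIT.
by rewrite setIACA setICr setI0.
Qed.

Lemma integrable_mrestr (f : T -> \bar R) :
  (mrestr mu mD).-integrable setT f -> mu.-integrable D f.
Proof.
move=> /integrableP[mf foo]; apply/integrableP; split.
  exact: measurable_funTS.
rewrite -ge0_integral_mrestr//.
exact: measurableT_comp.
Qed.

Lemma ae_mrestr (P : T -> Prop) :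
  (\forall x \ae mrestr mu mD, P x) -> \forall x \ae mu, D x -> P x.
Proof.
move=> [N [mN N0 PN]]; exists (N `&` D); split => //; first exact: measurableI.
by move=> x /= /not_implyP[Dx nPx]; split => //; exact: PN.
Qed.

End restricted_integral.

Definition lebesgue01 (R : realType) :
    {measure set (measurableTypeR R) -> \bar R} :=
  mrestr lebesgue_measure (measurable_itv `]0%R, 1%R[).

(* Real L^2(0,1). Elements are almost-everywhere classes of functions on R for
   Lebesgue measure restricted to (0,1); the coercion of a class to a function
   picks a representative, so pointwise statements are meant a.e. *)
Definition L2 R := LspaceType2 (lebesgue01 R).
HB.instance Definition _ R := GRing.Lmodule.on (L2 R).

Section operators.
Variable R : realType.
Local Notation mu := (@lebesgue_measure R).
Implicit Types f g : L2 R.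

Let mI : measurable (`]0%R, 1%R[%classic : set (measurableTypeR R)).
Proof. exact: measurable_itv. Qed.

Lemma L2_integrable01 f : mu.-integrable `]0%R, 1%R[ (EFin \o (f : R -> R)).
Proof.
apply: (@integrable_mrestr _ _ _ mu _ (measurable_itv `]0%R, 1%R[)).
apply/Lfun1_integrable; apply: Lfun_subset12; last exact: LfunP (Lrepr f).
by rewrite /= /mrestr setTI lebesgue_measure_itv/= lte01.
Qed.

Lemma L2_ae01 f g : (f : R -> R) = g %[ae lebesgue01 R] ->
  \forall x \ae mu, `]0, 1[%classic x -> f x = g x.
Proof.
by move=> fg; have := ae_mrestr fg; apply: filterS => x h /h; exact.
Qed.

Definition Kfun f (x : R) : R :=
  - 2^-1 * \int[mu]_(y in `]0, 1[) (`|x - y| * f y).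

Lemma measurable_L2 f : measurable_fun setT (f : R -> R).
Proof. exact: (@measurable_funPT _ _ _ _ (Lrepr f)). Qed.

Lemma Kfun_integrable f x :
  mu.-integrable `]0%R, 1%R[ (EFin \o (fun y : R => `|x - y| * f y)).
Proof.
have fi := L2_integrable01 f.
have := integrableZl mI (`|x| + 1) fi.
apply: le_integrable => //.
- apply/measurable_EFinP; apply: measurable_funM.
    apply: measurableT_comp => //; exact: measurable_funB.
  by apply: measurable_funTS; exact: measurable_L2.
- move=> y /=; rewrite in_itv/= => /andP[y0 y1].
  rewrite lee_fin !normrM normr_id ler_wpM2r//.
  rewrite (le_trans (ler_normB _ _))// [leRHS]ger0_norm ?addr_ge0// lerD2l.
  by rewrite ger0_norm ltW.
Qed.

Let L1norm f := \int[mu]_(y in `]0, 1[) `|f y|.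

Lemma KfunB f x x' : `|Kfun f x - Kfun f x'| <= 2^-1 * (`|x - x'| * L1norm f).
Proof.
rewrite /Kfun -mulrBr normrM normrN (@ger0_norm _ 2^-1) ?invr_ge0//.
rewrite ler_wpM2l ?invr_ge0//.
rewrite -RintegralB//; [|exact: Kfun_integrable|exact: Kfun_integrable].
apply: le_trans (le_normr_Rintegral _ _) _ => //.
  have := integrableB _ (Kfun_integrable f x) (Kfun_integrable f x').
  exact.
rewrite /L1norm -RintegralZl//; last exact: integrable_norm (L2_integrable01 f).
apply: le_Rintegral => //.
- have := integrableB _ (Kfun_integrable f x) (Kfun_integrable f x').
  by move=> /(_ mI) /integrable_norm.
- by have /integrable_norm/(integrableZl mI) := L2_integrable01 f; exact.
move=> y _; rewrite -mulrBl normrM ler_wpM2r//.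
by rewrite (le_trans (ler_dist_dist _ _))// opprB addrA subrK.
Qed.

Lemma Kfun_bound f x : `]0, 1[%classic x -> `|Kfun f x| <= L1norm f.
Proof.
rewrite /= in_itv/= => /andP[x0 x1].
rewrite /Kfun normrM normrN (@ger0_norm _ 2^-1) ?invr_ge0//.
apply: (@le_trans _ _ (1 * `|\int[mu]_(y in `]0, 1[) (`|x - y| * f y)|)).
  by rewrite ler_wpM2r// invf_le1// ler1n.
rewrite mul1r; apply: le_trans (le_normr_Rintegral _ (Kfun_integrable f x)) _ => //.
apply: le_Rintegral => //.
- exact: integrable_norm (Kfun_integrable f x).
- exact: integrable_norm (L2_integrable01 f).
move=> y /=; rewrite in_itv/= => /andP[y0 y1].
rewrite normrM normr_id ler_piMl// ler_norml; apply/andP; split.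
  by rewrite -[-1]add0r lerD// ?lerN2 ltW.
by rewrite -[1]subr0 lerD// ?lerN2 ltW.
Qed.

Lemma continuous_Kfun f : continuous (Kfun f).
Proof.
have M0 : 0 < L1norm f + 1 by rewrite ltr_wpDl// Rintegral_ge0.
move=> x; apply/cvgrPdist_le => /= e e0; near=> z.
apply: (le_trans (KfunB f x z)).
apply: (@le_trans _ _ (`|x - z| * (L1norm f + 1))).
  rewrite -[leRHS]mul1r; apply: ler_pM => //.
  - by rewrite mulr_ge0// Rintegral_ge0.
  - by rewrite invf_le1// ler1n.
  - by rewrite ler_wpM2l// lerDl.
rewrite -ler_pdivlMr//.
near: z; apply: cvgr_dist_le; first exact: cvg_id.
exact: divr_gt0.
Unshelve. all: by end_near. Qed.

Lemma Kfun_Lfun f : Kfun f \in Lfun (lebesgue01 R) 2%:E.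
Proof.
have mK : measurable_fun setT (Kfun f).
  by apply: continuous_measurable_fun; exact: continuous_Kfun.
apply/andP; split; rewrite inE//= /finite_norm unlock.
apply: poweR_lty.
have mP : measurable_fun setT (fun x => (`|(EFin \o Kfun f) x| `^ 2)%E).
  apply: (@measurableT_comp _ _ _ _ _ _ (fun y : \bar R => y `^ 2)%E).
    exact: measurable_poweR.
  by apply: measurableT_comp => //; apply/measurable_EFinP.
rewrite ge0_integral_mrestr//; last by move=> x; exact: poweR_ge0.
apply: (@le_lt_trans _ _ (\int[mu]_(x in `]0%R, 1%R[) (powR (L1norm f) 2)%:E)%E).
  apply: ge0_le_integral => //.
  - by move=> x _; exact: poweR_ge0.
  - exact: measurable_funTS.
  - move=> x x01; rewrite /= lee_fin.
    by rewrite ge0_ler_powR ?nnegrE ?Rintegral_ge0//; exact: Kfun_bound.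
rewrite integral_cst//= lebesgue_measure_itv/= lte01.
by rewrite oppr0 adde0 mule1 ltry.
Qed.

Definition K f : L2 R := Lclass (Lfun_Sub (lee1n 2) (Kfun_Lfun f)).

Lemma K_ae f : (K f : R -> R) = Kfun f %[ae lebesgue01 R].
Proof. exact: Lclass_ae. Qed.

Lemma K_is_linear : linear K.
Proof.
move=> a f g; apply/Lspace_eqP.
apply: (ae_app (K_ae (a *: f + g))); apply: (ae_app (K_ae f)).
apply: (ae_app (K_ae g)); apply: (ae_app (LspaceDE (a *: K f) (K g))).
apply: (ae_app (LspaceZE a (K f))).
apply: aeW => x h1 h2 h3 h4 h5 _.
rewrite h5// h2 h1 h3// h4//.
rewrite /Kfun mulrCA -mulrDr; congr (_ * _).
rewrite -RintegralZl//; last exact: Kfun_integrable.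
rewrite -RintegralD//; [|exact: integrableZl (Kfun_integrable f x)
  |exact: Kfun_integrable].
have afgE : \forall y \ae mu,
    `]0, 1[%classic y -> (a *: f + g : L2 R) y = a * f y + g y.
  have := ae_mrestr (LspaceDE (a *: f) g).
  have := ae_mrestr (LspaceZE a f).
  by apply: filterS2 => y zE dE y01; rewrite dE// zE.
rewrite /Rintegral; congr fine; apply: ae_eq_integral => //.
- by have /integrableP[] := Kfun_integrable (a *: f + g) x.
- have /integrableP[+ _] := integrableD mI
    (integrableZl mI a (Kfun_integrable f x)) (Kfun_integrable g x).
  exact.
- apply: (ae_app afgE); apply: aeW => y /= h y01; rewrite h//.
  by rewrite /= mulrDr mulrCA.
Qed.

HB.instance Definition _ := GRing.isLinear.Build R (L2 R) (L2 R) _ K K_is_linear.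

Lemma cst1_Lfun : cst 1 \in Lfun (lebesgue01 R) 2%:E.
Proof.
apply/andP; split; rewrite inE//= /finite_norm.
rewrite (_ : EFin \o cst 1 = cst 1%E)//.
rewrite Lnorm_cst1 poweR_lty// /= /mrestr setTI lebesgue_measure_itv/= lte01.
by rewrite oppr0 adde0 ltry.
Qed.

Definition u1 : L2 R := Lclass (Lfun_Sub (lee1n 2) cst1_Lfun).

Definition inner f g : R := \int[mu]_(x in `]0, 1[) (f x * g x).

(* Test functions: C^1 with compact support in (0,1). In dimension one these
   give the same Sobolev spaces as smooth test functions. *)
Definition C1c01 (phi : R -> R) : Prop :=
  [/\ forall x, derivable phi x 1, continuous phi^`()%classic,
      compact (closure [set x | phi x != 0]) &
      closure [set x | phi x != 0] `<=` `]0, 1[].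

Definition is_weak_derivative (u v : L2 R) : Prop :=
  forall phi, C1c01 phi ->
    \int[mu]_(x in `]0, 1[) (u x * phi^`()%classic x) =
    - \int[mu]_(x in `]0, 1[) (v x * phi x).

(* the weak derivative, which is unique when it exists, and 0 otherwise *)
Definition wderiv (u : L2 R) : L2 R := xget 0 [set v | is_weak_derivative u v].

Definition H1 : set (L2 R) := [set u | exists v, is_weak_derivative u v].
Definition H2 : set (L2 R) := [set u | H1 u /\ H1 (wderiv u)].

Definition continuous_representative (u : L2 R) (U : R -> R) : Prop :=
  {within `[0, 1], continuous U} /\
  \forall x \ae mu, `]0, 1[%classic x -> u x = U x.

(* The boundary values of u and u' are those of their continuous
   representatives on [0,1], which exist and are unique for u in H2. *)
Definition antiperiodic_bc (u : L2 R) : Prop :=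
  exists U0 U1 : R -> R,
    [/\ continuous_representative u U0,
        continuous_representative (wderiv u) U1,
        U0 0 = - U0 1 & U1 0 = - U1 1].

(* A possibly unbounded operator; its values outside its domain are
   irrelevant. *)
Record unbounded_operator := UnboundedOperator {
  op_dom : set (L2 R) ;
  op_fun :> L2 R -> L2 R }.

Definition op_ker (A : unbounded_operator) : set (L2 R) :=
  [set u | op_dom A u /\ A u = 0].

Definition antiperiodic_op : unbounded_operator :=
  UnboundedOperator (H2 `&` antiperiodic_bc) (fun u => - wderiv (wderiv u)).

Definition is_orthogonal_projection (P : L2 R -> L2 R) (N : set (L2 R)) : Prop :=
  forall f, N (P f) /\ forall g, N g -> inner (f - P f) g = 0.

Definition bounded_op (S : L2 R -> L2 R) : Prop :=
  exists M : R, forall f : L2 R,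
    ('N[lebesgue01 R]_2%:E[EFin \o S f] <=
     M%:E * 'N[lebesgue01 R]_2%:E[EFin \o f])%E.

Definition is_green_operator (A : unbounded_operator)
    (S : {linear L2 R -> L2 R}) : Prop :=
  bounded_op S /\
  exists2 P : L2 R -> L2 R, is_orthogonal_projection P (op_ker A) &
    forall f, [/\ op_dom A (S f), A (S f) = f - P f, S (P f) = 0 & P (S f) = 0].

End operators.

Arguments u1 {R}.
Arguments antiperiodic_op {R}.

Definition has_rank (F : fieldType) (U V : lmodType F) (T : {linear U -> V})
    (n : nat) : Prop :=
  exists2 e : 'I_n -> V,
    forall c : 'I_n -> F, \sum_(i < n) c i *: e i = 0 -> forall i, c i = 0 &
    range T = [set \sum_(i < n) c i *: e i | c in [set: 'I_n -> F]].

(* Main.v *)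
Require Import Defs.
From HB Require Import structures.
From mathcomp Require Import all_boot all_order all_algebra.
From mathcomp Require Import all_classical all_reals all_analysis.
From mathcomp Require Import measurable_realfun.
From mathcomp Require Import ring lra.

Import Order.TTheory GRing.Theory Num.Theory.
Import numFieldNormedType.Exports.

(** Everything rests on one description of weak derivatives on (0,1):
    [V] is a weak derivative of [U] exactly when [U] is almost everywhere a
    constant plus the primitive of [V] vanishing at 0 ([weak_derivativeP]).
    One direction is integration by parts against a test function, obtained
    by exchanging two integrals ([prim_swap], [prim_by_parts]).  The other is
    the lemma of du Bois-Reymond ([du_bois_reymond]), which comes from the
    fundamental lemma of the calculus of variations, proved here for tent
    functions and Lebesgue points ([fundamental_lemma]).

    With m the integral of f and n that of y f(y), the equation -u'' = f then
    says u' = c1 - F and u = c0 + (primitive of u'), where F is the primitive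
    of f.  The antiperiodic conditions are two linear equations, u'(0) = -u'(1)
    giving c1 = m / 2 and u(0) = -u(1) giving c0 = m / 4 - n / 2.
    On the other hand, since |x - y| = 2 max(0, x - y) - (x - y), the function
    K f is also the primitive of m / 2 - F, now with the constant - n / 2
    ([Kfun_prim]).  Hence u = K f + m / 4 is the only solution
    ([antiperiodic_solution]).

    So the operator has trivial kernel, the projection onto its kernel is zero,
    and f |-> K f + (m / 4) u1 is the one and only Green's operator
    ([green_is_green], [green_unique]).  Its difference with K is
    f |-> - (m / 4) u1, whose range is the line spanned by u1. *)

Set Implicit Arguments.
Unset Strict Implicit.
Unset Printing Implicit Defensive.

Local Open Scope classical_set_scope.
Local Open Scope ring_scope.

(** * Integrals over the unit interval *)

Section unit_interval.
Variable R : realType.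
Local Notation mu := (@lebesgue_measure R).
Local Notation I := (`]0%R, 1%R[%classic : set R).
Implicit Types (f g h : R -> R) (a b x : R).

Lemma integrable_cond (b : pred R) f : measurable_fun setT b ->
  mu.-integrable I (EFin \o f) ->
  mu.-integrable I (EFin \o (fun t => (b t)%:R * f t)).
Proof.
move=> mb fi; apply: (le_integrable _ _ _ fi) => //.
  apply/measurable_EFinP; apply: measurable_funM.
    apply: measurable_funTS.
    by apply: (@measurableT_comp _ _ _ _ _ _ (fun b : bool => b%:R : R)).
  by apply/measurable_EFinP; case/integrableP: fi.
move=> t _; rewrite lee_fin /= normrM.
by case: (b t); rewrite ?normr1 ?normr0 ?mul1r ?mul0r.
Qed.

Lemma integrable_closure f : mu.-integrable I (EFin \o f) ->
  mu.-integrable `[0, 1] (EFin \o f).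
Proof.
move=> /integrableP[mf foo].
have /emeasurable_fun_itv_bndo_bndcP mf' := mf.
apply/integrableP; split.
  by apply/emeasurable_fun_itv_obnd_cbndP.
rewrite -integral_itv_obnd_cbnd; last by apply: measurableT_comp.
rewrite -integral_itv_bndo_bndc//.
by apply: measurableT_comp.
Qed.

Lemma integrable_mulr f h M : mu.-integrable I (EFin \o f) ->
  measurable_fun I h -> (forall x, I x -> `|h x| <= M) ->
  mu.-integrable I (EFin \o (fun x => f x * h x)).
Proof.
move=> fi mh hM; apply: (le_integrable _ _ _ (integrableZl _ M fi)) => //.
  apply/measurable_EFinP; apply: measurable_funM => //.
  by apply/measurable_EFinP; case/integrableP: fi.
move=> x Ix; rewrite lee_fin /= !normrM mulrC ler_wpM2r// (le_trans (hM _ Ix))//.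
exact: ler_norm.
Qed.

Lemma integrableRB f g :
  mu.-integrable I (EFin \o f) -> mu.-integrable I (EFin \o g) ->
  mu.-integrable I (EFin \o (fun x => f x - g x)).
Proof. by move=> fi gi; exact: (integrableB _ fi gi). Qed.

Lemma integrableRZ k f : mu.-integrable I (EFin \o f) ->
  mu.-integrable I (EFin \o (fun x => k * f x)).
Proof. by move=> fi; exact: (integrableZl _ k fi). Qed.

Lemma continuous_integrable f : {within `[0, 1], continuous f} ->
  mu.-integrable I (EFin \o f).
Proof.
move=> cf; apply: (@integrableS _ _ _ mu `[0, 1]) => //.
  exact: subset_itv_oo_cc.
by apply: continuous_compact_integrable => //; exact: segment_compact.
Qed.

Lemma integrable_cst (k : R) : mu.-integrable I (EFin \o (fun=> k)).
Proof.
by apply: continuous_integrable; apply: continuous_subspaceT => x; exact: cvg_cst.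
Qed.

Lemma within_continuous_bounded f : {within `[0, 1], continuous f} ->
  exists M, forall x, I x -> `|f x| <= M.
Proof.
move=> cf; have /compact_bounded [M [_ bM]] : compact (f @` `[0, 1]).
  by apply: continuous_compact => //; exact: segment_compact.
exists (M + 1) => x Ix; apply: (bM (M + 1)); first by rewrite ltrDl.
by exists x => //; exact: subset_itv_oo_cc.
Qed.

Lemma Rintegral_ae_eq f g :
  mu.-integrable I (EFin \o f) -> mu.-integrable I (EFin \o g) ->
  (\forall x \ae mu, I x -> f x = g x) ->
  \int[mu]_(x in `]0, 1[) f x = \int[mu]_(x in `]0, 1[) g x.
Proof.
move=> /integrableP[mf _] /integrableP[mg _] fg; congr fine.
apply: ae_eq_integral => //; move: fg.
apply: filterS; first exact: (ae_filter_ringOfSetsType mu).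
by move=> x /= + Ix => ->.
Qed.

Lemma ae_interval a b (P : R -> Prop) : a < b -> (\forall x \ae mu, P x) ->
  exists2 x, a < x < b & P x.
Proof.
move=> ab [N [mN N0 sub]]; apply: contrapT => nP.
have : (mu `]a, b[ <= 0)%E.
  rewrite -N0; apply: le_measure; rewrite ?inE//.
  move=> x /=; rewrite in_itv /= => axb; apply: sub => Px; apply: nP.
  by exists x.
by rewrite lebesgue_measure_itv /= lte_fin ab -EFinB lee_fin subr_le0 leNgt ab.
Qed.

(** A point where the two functions differ would, by continuity, have a whole
    subinterval of (0,1) around or next to it on which they differ, and that
    interval has positive measure. *)
Lemma ae_eq_within_continuous f g :
  {within `[0, 1], continuous f} -> {within `[0, 1], continuous g} ->
  (\forall x \ae mu, I x -> f x = g x) -> forall x, 0 <= x <= 1 -> f x = g x.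
Proof.
move=> cf cg fg x x01.
have /subspace_continuousP cfg := within_continuousB cf cg.
apply/eqP; rewrite -subr_eq0; apply/negPn/negP => d0.
have x01' : `[0, 1]%classic x by rewrite /= in_itv.
have := cvgr_dist_lt _ _ (cfg x x01') `|f x - g x|.
rewrite normr_gt0 => /(_ (within_filter _ _) d0) [e /= e0 sub].
have [] := @ae_interval (Num.max 0 (x - e)) (Num.min 1 (x + e)) _ _ fg.
  by rewrite gt_max !lt_min; apply/andP; split; apply/andP; split; lra.
move=> y; rewrite gt_max lt_min => /andP[/andP[y0 y1] /andP[y2 y3]].
have Iy : I y by rewrite /= in_itv /= y0.
move=> /(_ Iy) fgy.
have : `|(f x - g x) - (f y - g y)| < `|f x - g x|.
  apply: (sub y); first by rewrite /ball /= ltr_norml; apply/andP; split; lra.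
  by rewrite /= in_itv /= (ltW y0) ltW.
by rewrite fgy subrr subr0 ltxx.
Qed.

End unit_interval.

(** * The primitive vanishing at 0 *)

Section primitive.
Variable R : realType.
Local Notation mu := (@lebesgue_measure R).
Local Notation I := (`]0%R, 1%R[%classic : set R).
Implicit Types (f g : R -> R) (x y : R).

Definition prim f x := \int[mu]_(t in `[0, x]) f t.

(** Writing the primitive as an integral over the fixed domain (0,1), with the
    moving bound inside the integrand, is what makes linearity, almost
    everywhere congruence and Fubini applicable. *)
Lemma prim_cond f x : mu.-integrable I (EFin \o f) -> 0 <= x <= 1 ->
  prim f x = \int[mu]_(t in `]0, 1[) ((t <= x)%R%:R * f t).
Proof.
move=> fi /andP[x0 x1]; have fc := integrable_closure fi.
rewrite /prim -Rintegral_itv_obnd_cbnd; last first.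
  apply: integrableS fc => //.
  by move=> t; rewrite /= !in_itv /= => /andP[? ?]; apply/andP; split; lra.
rewrite Rintegral_itv_bndo_bndc; last first.
  by apply: integrable_cond => //; exact: measurable_fun_ler.
rewrite (_ : `]0, x]%classic = `]0, 1] `&` [set t | t <= x]); last first.
  apply/seteqP; split => t /=; rewrite !in_itv /=.
    by move=> /andP[-> tx]; rewrite tx (le_trans tx).
  by move=> [/andP[-> _] ->].
rewrite Rintegral_mkcondr; apply: eq_Rintegral => t _; rewrite patchE.
case: ifPn; first by rewrite inE /= => ->; rewrite mul1r.
by rewrite notin_setE /= => /negP/negbTE ->; rewrite mul0r.
Qed.

Lemma coprim_cond f x : mu.-integrable I (EFin \o f) -> 0 <= x <= 1 ->
  \int[mu]_(t in `[x, 1]) f t = \int[mu]_(t in `]0, 1[) ((x <= t)%R%:R * f t).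
Proof.
move=> fi /andP[x0 x1]; have fc := integrable_closure fi.
rewrite -Rintegral_itv_bndo_bndc; last first.
  apply: integrableS fc => //.
  by move=> t; rewrite /= !in_itv /= => /andP[? ?]; apply/andP; split; lra.
rewrite Rintegral_itv_obnd_cbnd; last first.
  by apply: integrable_cond => //; exact: measurable_fun_ler.
rewrite (_ : `[x, 1[%classic = `[0, 1[ `&` [set t | x <= t]); last first.
  apply/seteqP; split => t /=; rewrite !in_itv /=.
    by move=> /andP[xt ->]; rewrite xt (le_trans x0).
  by move=> [/andP[_ ->] ->].
rewrite Rintegral_mkcondr; apply: eq_Rintegral => t _; rewrite patchE.
case: ifPn; first by rewrite inE /= => ->; rewrite mul1r.
by rewrite notin_setE /= => /negP/negbTE ->; rewrite mul0r.
Qed.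

Lemma Rfubini (k : R * R -> R) :
  (mu \x mu)%E.-integrable setT (EFin \o k) ->
  (forall x, mu.-integrable setT (EFin \o (fun y => k (x, y)))) ->
  (forall y, mu.-integrable setT (EFin \o (fun x => k (x, y)))) ->
  \int[mu]_x \int[mu]_y k (x, y) = \int[mu]_y \int[mu]_x k (x, y).
Proof.
move=> ik ikx iky; rewrite /Rintegral; congr fine.
under eq_integral => x _ do rewrite fineK ?(integrable_fin_num _ (ikx x))//.
under [RHS]eq_integral => y _
  do rewrite fineK ?(integrable_fin_num _ (iky y))//.
exact: (Fubini ik).
Qed.

(** Both sides are the double integral of f(y) g(x) over the triangle
    y <= x of the unit square. *)
Lemma prim_swap f g :
  mu.-integrable I (EFin \o f) -> mu.-integrable I (EFin \o g) ->
  \int[mu]_(x in `]0, 1[) (prim f x * g x) =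
  \int[mu]_(y in `]0, 1[) (f y * \int[mu]_(x in `[y, 1]) g x).
Proof.
move=> fi gi.
pose f0 := f \_ I; pose g0 := g \_ I.
have f0i : mu.-integrable setT (EFin \o f0).
  by rewrite -restrict_EFin; apply/(integrable_mkcond _ _).1.
have g0i : mu.-integrable setT (EFin \o g0).
  by rewrite -restrict_EFin; apply/(integrable_mkcond _ _).1.
have mf0 : measurable_fun setT f0.
  by apply/measurable_EFinP; case/integrableP: f0i.
have mg0 : measurable_fun setT g0.
  by apply/measurable_EFinP; case/integrableP: g0i.
pose k (p : R * R) := ((p.2 <= p.1)%R%:R * f0 p.2) * g0 p.1.
have mk : measurable_fun setT k.
  apply: measurable_funM; last by apply: measurableT_comp.
  apply: measurable_funM; last by apply: measurableT_comp.
  apply: (@measurableT_comp _ _ _ _ _ _ (fun b : bool => b%:R : R)) => //.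
  exact: measurable_fun_ler.
have kle x y : `|k (x, y)| <= `|f0 y * g0 x|.
  rewrite /k /= -mulrA normrM.
  by case: (y <= x); rewrite ?normr1 ?normr0 ?mul1r ?mul0r.
have ikx : forall x, mu.-integrable setT (EFin \o (fun y => k (x, y))).
  move=> x; apply: (le_integrable _ _ _ (integrableZl _ (g0 x) f0i)) => //.
  - by apply/measurable_EFinP; apply: (measurableT_comp mk).
  - by move=> y _; rewrite lee_fin /= mulrC kle.
have iky : forall y, mu.-integrable setT (EFin \o (fun x => k (x, y))).
  move=> y; apply: (le_integrable _ _ _ (integrableZl _ (f0 y) g0i)) => //.
  - by apply/measurable_EFinP; apply: (measurableT_comp mk).
  - by move=> x _; rewrite lee_fin /= kle.
have ik : (mu \x mu)%E.-integrable setT (EFin \o k).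
  apply/integrable12ltyP; first exact/measurable_EFinP.
  apply: (@le_lt_trans _ _ (\int[mu]_x (\int[mu]_y `|(f0 y)%:E| * `|(g0 x)%:E|))%E).
    apply: ge0_le_integral => //.
    - by move=> x _; apply: integral_ge0.
    - have mk2 : measurable_fun setT (fun p => `|(EFin \o k) p|%E).
        by apply: measurableT_comp => //; exact/measurable_EFinP.
      have k0 p : (0 <= `|(EFin \o k) p|)%E by [].
      have := measurable_fun_fubini_tonelli_F (m2 := mu) _ mk2 k0; exact.
    - apply: measurable_funeM; apply: measurableT_comp => //.
      exact/measurable_EFinP.
    move=> x _; rewrite muleC -ge0_integralZl//; last first.
      by apply: measurableT_comp => //; exact/measurable_EFinP.
    apply: ge0_le_integral => //.
    - by case/integrableP: (ikx x) => ? _; apply: measurableT_comp.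
    - apply: measurable_funeM; apply: measurableT_comp => //.
      exact/measurable_EFinP.
    - by move=> y _; rewrite /= -EFinM lee_fin -normrM mulrC kle.
  rewrite ge0_integralZl//; last 2 first.
  - by apply: measurableT_comp => //; exact/measurable_EFinP.
  - by apply: integral_ge0.
  apply: lte_mul_pinfty => //.
  - by apply: integral_ge0.
  - by rewrite ge0_fin_numE ?integral_ge0//; case/integrableP: f0i.
  - by case/integrableP: g0i.
(* The kernel k is supported on the triangle, and its partial integrals are
   the two integrands of the statement. *)
rewrite Rintegral_mkcond [RHS]Rintegral_mkcond.
transitivity (\int[mu]_x \int[mu]_y k (x, y)); last rewrite Rfubini//.
- apply: eq_Rintegral => x _; rewrite patchE; case: ifPn => [xI|xI].
    have /andP[x0 x1] : 0 < x < 1 by move: xI; rewrite inE /= in_itv.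
    rewrite prim_cond ?(ltW x0) ?(ltW x1)// -RintegralZr//; last first.
      by apply: integrable_cond => //; exact: measurable_fun_ler.
    rewrite Rintegral_mkcond; apply: eq_Rintegral => y _.
    rewrite /k /f0 /g0 !patchE xI /=.
    by case: ifPn => // _; rewrite ?mulr0 ?mul0r.
  rewrite [RHS](@eq_Rintegral _ _ _ _ _ (cst 0)); last first.
    by move=> y _; rewrite /k /g0 /= patchE (negbTE xI) mulr0.
  by rewrite Rintegral_cst// mul0r.
- apply: eq_Rintegral => y _; rewrite [RHS]patchE; case: ifPn => [yI|yI].
    have /andP[y0 y1] : 0 < y < 1 by move: yI; rewrite inE /= in_itv.
    rewrite coprim_cond ?(ltW y0) ?(ltW y1)// -RintegralZl//; last first.
      by apply: integrable_cond => //; exact: measurable_fun_ler.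
    rewrite [RHS]Rintegral_mkcond; apply: eq_Rintegral => x _.
    rewrite /k [RHS]patchE /g0 /f0 /= !patchE yI.
    by case: ifPn => _; [ring|exact: mulr0].
  rewrite [LHS](@eq_Rintegral _ _ _ _ _ (cst 0)); last first.
    by move=> x _; rewrite /k /f0 /= patchE (negbTE yI) mulr0 mul0r.
  by rewrite Rintegral_cst// mul0r.
Qed.

Lemma prim_continuous f : mu.-integrable I (EFin \o f) ->
  {within `[0, 1], continuous (prim f)}.
Proof.
move=> fi; apply: parameterized_integral_continuous => //.
exact: integrable_closure.
Qed.

Lemma prim_integrable f : mu.-integrable I (EFin \o f) ->
  mu.-integrable I (EFin \o prim f).
Proof. by move=> fi; exact/continuous_integrable/prim_continuous. Qed.

Lemma prim0 f : prim f 0 = 0.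
Proof. by rewrite /prim set_itv1 Rintegral_set1. Qed.

Lemma primB f g x :
  mu.-integrable I (EFin \o f) -> mu.-integrable I (EFin \o g) ->
  0 <= x <= 1 -> prim (fun t => f t - g t) x = prim f x - prim g x.
Proof.
move=> fi gi x01; rewrite !prim_cond//; last exact: integrableRB.
rewrite -RintegralB//; [|by apply: integrable_cond => //; exact: measurable_fun_ler..].
by apply: eq_Rintegral => t _; rewrite mulrBr.
Qed.

Lemma eq_prim f g x :
  mu.-integrable I (EFin \o f) -> mu.-integrable I (EFin \o g) ->
  (\forall t \ae mu, I t -> f t = g t) -> 0 <= x <= 1 -> prim f x = prim g x.
Proof.
move=> fi gi fg x01; rewrite !prim_cond//.
apply: Rintegral_ae_eq; [by apply: integrable_cond => //; exact: measurable_fun_ler..|].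
apply: filterS fg; first exact: (ae_filter_ringOfSetsType mu).
by move=> t /[apply] ->.
Qed.

Lemma prim_cst k x : 0 <= x -> prim (fun=> k) x = k * x.
Proof.
move=> x0; rewrite /prim Rintegral_cst//= lebesgue_measure_itv /= lte_fin.
by case: ltgtP x0 => //= [x0 _|<- _]; rewrite ?subr0 ?mulr0.
Qed.

(** By Lebesgue differentiation a primitive is almost everywhere
    differentiable with derivative the integrand. *)
Lemma prim_eq0 f : mu.-integrable I (EFin \o f) ->
  (forall x, 0 <= x <= 1 -> prim f x = 0) -> \forall x \ae mu, I x -> f x = 0.
Proof.
move=> fi F0; pose f0 := f \_ I.
have f0i : mu.-integrable setT (EFin \o f0).
  by rewrite -restrict_EFin; apply/(integrable_mkcond _ _).1.
have f0i' A : measurable A -> mu.-integrable A (EFin \o f0).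
  by move=> mA; apply: integrableS f0i.
have f0E x : I x -> f0 x = f x by move=> Ix; rewrite /f0 patchE mem_set.
have F00 x : 0 <= x <= 1 -> prim f0 x = 0.
  move=> x01; rewrite -(F0 x x01); apply: eq_prim => //; first exact: f0i'.
  by apply: aeW => t; exact: f0E.
have f0loc := integrable_locally_restrict (measurable_itv _) fi.
have := @FTC1 R f0 (BLeft 0) (fun y => f0i' _ (measurable_itv _)) f0loc.
apply: filterS; first exact: (ae_filter_ringOfSetsType mu).
move=> x + Ix; rewrite -f0E//; move: (Ix); rewrite /= in_itv /= => /andP[x0 x1].
rewrite lte_fin x0 => /(_ isT) [_ <-].
(* Near a point of (0,1) the primitive is identically 0. *)
rewrite derive1E (@near_eq_derive _ _ _ _ (cst 0)) ?derive_cst//.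
near=> y; apply: F00; apply/andP; split; apply: ltW; near: y.
  exact: lt_nbhsr.
exact: lt_nbhsl.
Unshelve. all: by end_near. Qed.

End primitive.

(** * Test functions and integration by parts *)

Section test_functions.
Variable R : realType.
Local Notation mu := (@lebesgue_measure R).
Local Notation I := (`]0%R, 1%R[%classic : set R).
Implicit Types (f phi psi : R -> R) (a b x : R).

Lemma C1c01_out phi x : C1c01 phi -> ~ I x -> phi x = 0.
Proof.
move=> [_ _ _ sub] nIx; apply/eqP/negPn/negP => px; apply: nIx; apply: sub.
exact: subset_closure.
Qed.

Lemma C1c01_continuous phi : C1c01 phi -> continuous phi.
Proof.
by move=> [dphi _ _ _] x; apply/differentiable_continuous/derivable1_diffP/dphi.
Qed.

(** Test functions vanish at 1, so only the lower bound contributes. *)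
Lemma C1c01_FTC phi x : C1c01 phi -> 0 <= x < 1 ->
  \int[mu]_(t in `[x, 1]) phi^`()%classic t = - phi x.
Proof.
move=> phiC /andP[x0 x1]; have phic := C1c01_continuous phiC.
have phi1 : phi 1 = 0 by apply: C1c01_out => //; rewrite /= in_itv /= ltxx andbF.
case: (phiC) => dphi cphi _ _.
have -> : \int[mu]_(t in `[x, 1]) phi^`()%classic t =
    fine ((phi 1)%:E - (phi x)%:E).
  congr fine; apply: continuous_FTC2 => [//| | |t _].
  - exact: continuous_subspaceT.
  - split => [t _| |].
    + exact: dphi.
    + by apply: cvg_at_right_filter; exact: phic.
    + by apply: cvg_at_left_filter; exact: phic.
  - by [].
by rewrite /= phi1 sub0r.
Qed.

Lemma C1c01_deriv_integrable phi : C1c01 phi ->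
  mu.-integrable I (EFin \o phi^`()%classic).
Proof.
by move=> [_ cphi _ _]; apply/continuous_integrable/continuous_subspaceT.
Qed.

Lemma integrable_C1c01 f phi : mu.-integrable I (EFin \o f) -> C1c01 phi ->
  mu.-integrable I (EFin \o (fun x => f x * phi^`()%classic x)).
Proof.
move=> fi [_ cphi _ _].
have [M bM] := within_continuous_bounded (continuous_subspaceT cphi).
apply: (integrable_mulr fi _ bM).
by apply: measurable_funTS; exact: continuous_measurable_fun.
Qed.

Lemma C1c01_integral_deriv phi : C1c01 phi ->
  \int[mu]_(t in `]0, 1[) phi^`()%classic t = 0.
Proof.
move=> phiC; have phii := C1c01_deriv_integrable phiC.
rewrite Rintegral_itv_obnd_cbnd//.
have FTC0 : \int[mu]_(t in `[0, 1]) phi^`()%classic t = 0.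
  by rewrite C1c01_FTC ?lexx ?ltr01// (C1c01_out phiC) ?oppr0//= in_itv/= ltxx.
rewrite -[RHS]FTC0 Rintegral_itv_bndo_bndc//.
apply: (integrableS _ _ _ (integrable_closure phii)) => //.
by apply: subset_itvl; rewrite bnd_simp.
Qed.

(** After exchanging the integrals, the inner one is that of phi' over
    [y, 1], which is - phi(y). *)
Lemma prim_by_parts f phi : mu.-integrable I (EFin \o f) -> C1c01 phi ->
  \int[mu]_(x in `]0, 1[) (prim f x * phi^`()%classic x) =
  - \int[mu]_(x in `]0, 1[) (f x * phi x).
Proof.
move=> fi phiC; rewrite prim_swap//; last exact: C1c01_deriv_integrable.
have phic := C1c01_continuous phiC.
have [M bM] := within_continuous_bounded (continuous_subspaceT phic).
rewrite -[RHS]mulN1r -RintegralZl//; last first.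
  apply: (integrable_mulr fi _ bM); apply: measurable_funTS.
  exact: continuous_measurable_fun.
apply: eq_Rintegral => y; rewrite inE /= in_itv /= => /andP[y0 y1].
by rewrite (C1c01_FTC phiC) ?(ltW y0)//; ring.
Qed.

(** The primitive of psi starting from minus infinity is zero to the left of
    the support of psi, and also to its right because psi has mean zero.
    Starting from minus infinity rather than from 0 makes it differentiable on
    the whole line. *)
Lemma C1c01_primitive psi a b : 0 < a -> b < 1 -> continuous psi ->
  (forall x, ~~ (a <= x <= b) -> psi x = 0) ->
  \int[mu]_(t in `]0, 1[) psi t = 0 ->
  exists2 phi, C1c01 phi & phi^`()%classic = psi.
Proof.
move=> a0 b1 cpsi psi0 mean0.
have inI x : a <= x <= b -> I x.
  by move=> /andP[? ?]; rewrite /= in_itv /=; apply/andP; split; lra.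
have psiI : psi \_ I = psi.
  apply/funext => x; rewrite patchE; case: ifPn => //; rewrite notin_setE => xI.
  by rewrite psi0//; apply/negP => /inI.
have psii : mu.-integrable setT (EFin \o psi).
  rewrite -psiI -restrict_EFin; apply/(integrable_mkcond _ _).1 => //.
  exact/continuous_integrable/continuous_subspaceT.
pose phi x := \int[mu]_(t in `]-oo, x]) psi t.
have phiD x : derivable phi x 1 /\ phi^`()%classic x = psi x.
  apply: (@continuous_FTC1 _ psi -oo%O x (x + 1)) => //.
  - by rewrite ltrDl.
  - exact: integrableS psii.
  - by rewrite ltNyr.
  - exact: cpsi.
have phi' : phi^`()%classic = psi by apply/funext => x; case: (phiD x).
have phi0 x : ~~ (a <= x <= b) -> phi x = 0.
  rewrite negb_and -!ltNge => /orP[xa|bx].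
    rewrite /phi (@eq_Rintegral _ _ _ _ _ (cst 0)) ?Rintegral_cst ?mul0r//.
    move=> t; rewrite inE /= in_itv /= => tx; apply: psi0.
    by apply/negP => /andP[? _]; lra.
  rewrite -mean0 /phi Rintegral_mkcond [RHS]Rintegral_mkcond psiI.
  congr (Rintegral _ _ _); apply/funext => t; rewrite patchE; case: ifPn => //.
  rewrite notin_setE /= in_itv /= => /negP; rewrite -ltNge => xt.
  by rewrite psi0//; apply/negP => /andP[_ ?]; lra.
exists phi => //; have supp : closure [set x | phi x != 0] `<=` `[a, b].
  have -> : `[a, b]%classic = closure (`[a, b]%classic : set R).
    exact/closure_id/interval_closed.
  apply: closure_subset => x /=; rewrite in_itv /=; apply: contraR => /phi0 ->.
  by rewrite eqxx.
split.
- by move=> x; case: (phiD x).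
- by rewrite phi'.
- apply: (subclosed_compact _ (@segment_compact _ a b) supp).
  exact: closed_closure.
- by move=> x /supp; rewrite /= in_itv /= => /inI; rewrite /= in_itv.
Qed.

End test_functions.

(** * Tent functions and the fundamental lemma *)

Section tents.
Variable R : realType.
Local Notation mu := (@lebesgue_measure R).
Local Notation I := (`]0%R, 1%R[%classic : set R).
Implicit Types (f v : R -> R) (c r x : R).

(** Tents replace smooth bumps: continuity is enough for the primitive of a
    combination of tents to be a C^1 test function. *)
Definition tent c r x : R := Num.max 0 (r - `|x - c|).

Lemma tent_ge0 c r x : 0 <= tent c r x.
Proof. by rewrite /tent le_max lexx. Qed.

Lemma tent_le c r x : 0 <= r -> tent c r x <= r.
Proof. by move=> r0; rewrite /tent ge_max r0 /= lerBlDr lerDl. Qed.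

Lemma tent_out c r x : r <= `|x - c| -> tent c r x = 0.
Proof. by move=> rx; apply/max_idPl; rewrite subr_le0. Qed.

Lemma continuous_tent c r : continuous (tent c r).
Proof.
have -> : tent c r = fun x => (r - `|x - c| + `|r - `|x - c| |) / 2.
  by apply/funext => x; rewrite /tent maxr_absE add0r sub0r normrN.
have cu : continuous (fun x => r - `|x - c|).
  move=> x; apply: cvgB; first exact: cvg_cst.
  by apply: cvg_norm; apply: cvgB; [exact: cvg_id|exact: cvg_cst].
move=> x; apply: cvgM; last exact: cvg_cst.
by apply: cvgD; [exact: cu|apply: cvg_norm; exact: cu].
Qed.

Lemma tent_integrable c r : mu.-integrable I (EFin \o tent c r).
Proof. exact/continuous_integrable/continuous_subspaceT/continuous_tent. Qed.

Lemma integrable_tent f c r : 0 <= r -> mu.-integrable I (EFin \o f) ->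
  mu.-integrable I (EFin \o (fun x => f x * tent c r x)).
Proof.
move=> r0 fi; apply: (@integrable_mulr _ _ _ r) => //.
  by apply: measurable_funTS; apply: continuous_measurable_fun; exact: continuous_tent.
by move=> x _; rewrite ger0_norm ?tent_ge0 ?tent_le.
Qed.

(** On the concentric interval of half the radius, whose length is r, the tent
    is at least r / 2. *)
Lemma tent_mass c r : 0 < r -> 0 < c - r -> c + r < 1 ->
  r ^+ 2 / 2 <= \int[mu]_(x in `]0, 1[) tent c r x.
Proof.
move=> r0 cr0 cr1.
have ti := tent_integrable c r.
rewrite -lee_fin [leRHS]fineK; last exact: integrable_fin_num.
have r20 : 0 <= r / 2 by rewrite divr_ge0// ltW.
have sub : ball c (r / 2) `<=` I.
  move=> x; rewrite /ball /= ltr_norml in_itv /= => /andP[? ?].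
  by apply/andP; split; lra.
have mt : measurable_fun I (fun x => (tent c r x)%:E).
  by case/integrableP: ti.
have t0 x : I x -> (0 <= (tent c r x)%:E)%E.
  by move=> _; rewrite lee_fin tent_ge0.
have mb := measurable_ball c (r / 2).
apply: le_trans (ge0_subset_integral mu mb (measurable_itv _) mt t0 sub).
apply: (@le_trans _ _ (\int[mu]_(x in ball c (r / 2)) (r / 2)%:E)%E).
  rewrite integral_cst; last exact: measurable_ball.
  apply: (@le_trans _ _ ((r / 2)%:E * (r / 2 *+ 2)%:E)%E); last first.
    by rewrite -(lebesgue_measure_ball c r20).
  by rewrite -EFinM lee_fin le_eqVlt; apply/orP; left; apply/eqP; field.
apply: ge0_le_integral => //.
- exact: measurable_funS mt.
- move=> x; rewrite /ball /= => cx; rewrite lee_fin /tent le_max.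
  by apply/orP; right; rewrite distrC; lra.
Qed.

(** If v is orthogonal to the tent T of radius r at x, then v(x) times the mass
    of T is the integral of (v(x) - v) T, hence at most r times the integral of
    |v - v(x)| over the ball.  The mass being at least r^2 / 2 and the ball of
    length 2 r, this bounds |v(x)| by 4 times the mean deviation of v from
    v(x), which tends to 0 with r at every Lebesgue point. *)
Lemma tent_average v x r : mu.-integrable I (EFin \o v) ->
  0 < r -> 0 < x - r -> x + r < 1 ->
  \int[mu]_(t in `]0, 1[) (v t * tent x r t) = 0 ->
  ((`|v x| / 4)%:E <= davg (v \_ I) x r)%E.
Proof.
move=> vi r0 xr0 xr1 v0.
have Ix : x \in I by rewrite inE /= in_itv /=; apply/andP; split; lra.
have sub : ball x r `<=` I.
  move=> t; rewrite /ball /= ltr_norml in_itv /= => /andP[? ?].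
  by apply/andP; split; lra.
have mb := measurable_ball x r.
have ti := tent_integrable x r.
have vti := integrable_tent x (ltW r0) vi.
pose w t := (v \_ I) t - (v \_ I) x.
have vIi : mu.-integrable setT (EFin \o (v \_ I)).
  by rewrite -restrict_EFin; apply/(integrable_mkcond _ _).1.
have mw : measurable_fun setT w.
  apply: measurable_funB => //.
  by apply/measurable_EFinP; case/integrableP: vIi.
have step : ((`|v x| * (r ^+ 2 / 2))%:E <=
    r%:E * \int[mu]_(t in ball x r) `|(w t)%:E|)%E.
  have T0 := tent_mass r0 xr0 xr1.
  apply: (@le_trans _ _ (`|\int[mu]_(t in `]0, 1[)
      (v x * tent x r t - v t * tent x r t)|%:E)).
    rewrite lee_fin RintegralB//; last exact: integrableRZ.
    rewrite v0 subr0 RintegralZl// normrM ler_wpM2l// (le_trans T0)//.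
    exact: ler_norm.
  rewrite EFin_normr_Rintegral//; last first.
    by apply: integrableRB => //; exact: integrableRZ.
  have /integrableP[mI _] := integrableRB (integrableRZ (v x) ti) vti.
  apply: le_trans (le_abse_integral _ _ mI) _ => //.
  rewrite -ge0_integralZl//; last 2 first.
  - by apply: measurable_funTS; apply: measurableT_comp => //; exact/measurable_EFinP.
  - by rewrite lee_fin ltW.
  rewrite integral_mkcond [leRHS]integral_mkcond.
  apply: ge0_le_integral => //.
  - by move=> t _; apply: erestrict_ge0.
  - by apply/(measurable_restrictT _ _).1 => //; exact: measurableT_comp.
  - apply/(measurable_restrictT _ _).1 => //; apply: measurable_funTS.
    by apply: measurable_funeM; apply: measurableT_comp => //;
      exact/measurable_EFinP.
  move=> t _; rewrite !patchE; case: ifPn => [tI|_]; case: ifPn => [tb|tb] //=.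
  - rewrite -EFinM lee_fin -mulrBl normrM [`|tent _ _ _|]ger0_norm ?tent_ge0// mulrC.
    by rewrite distrC /w !patchE tI Ix ler_wpM2r// tent_le// ltW.
  - rewrite tent_out ?mulr0 ?subrr ?normr0//.
    by move: tb; rewrite notin_setE /ball /= distrC => /negP; rewrite -leNgt.
  - by rewrite mule_ge0// lee_fin ltW.
rewrite /davg /iavg.
have -> : mu (ball x r) = (r *+ 2)%:E.
  exact: (lebesgue_measure_ball x (ltW r0)).
rewrite inver mulrn_eq0 /= (gt_eqF r0).
(* Both sides are brought to a multiple of 1 / (2 r^2). *)
have -> : (`|v x| / 4)%:E = (((r ^+ 2 *+ 2)^-1)%:E * (`|v x| * (r ^+ 2 / 2))%:E)%E.
  by rewrite -EFinM; congr EFin; field; rewrite gt_eqF.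
have -> : ((r *+ 2)^-1)%:E = (((r ^+ 2 *+ 2)^-1)%:E * r%:E)%E.
  by rewrite -EFinM; congr EFin; field; rewrite gt_eqF.
by rewrite -muleA lee_wpmul2l// lee_fin invr_ge0 mulrn_wge0// sqr_ge0.
Qed.

Lemma fundamental_lemma v : mu.-integrable I (EFin \o v) ->
  (forall c r, 0 < r -> 0 < c - r -> c + r < 1 ->
    \int[mu]_(t in `]0, 1[) (v t * tent c r t) = 0) ->
  \forall x \ae mu, I x -> v x = 0.
Proof.
move=> vi v0.
have vloc : locally_integrable setT (v \_ I).
  exact: integrable_locally_restrict.
have := lebesgue_differentiation vloc.
apply: filterS; first exact: (ae_filter_ringOfSetsType mu).
move=> x vx Ix; move: (Ix); rewrite /= in_itv /= => /andP[x0 x1].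
have : ((`|v x| / 4)%:E <= 0)%E.
  have <- : (lim (davg (v \_ I) x r @[r --> (0%R:R)^'+]) = 0)%E by exact/cvg_lim.
  apply: lime_ge; first by apply/cvg_ex; exists 0%E.
  near=> r; apply: tent_average => //; last apply: v0 => //.
  - rewrite subr_gt0; near: r; exact: nbhs_right_lt.
  - by rewrite -ltrBrDl; near: r; apply: nbhs_right_lt; rewrite subr_gt0.
  - rewrite subr_gt0; near: r; exact: nbhs_right_lt.
  - by rewrite -ltrBrDl; near: r; apply: nbhs_right_lt; rewrite subr_gt0.
by rewrite lee_fin pmulr_lle0 ?invr_gt0// normr_le0 => /eqP.
Unshelve. all: by end_near. Qed.

End tents.

(** * Weak derivatives *)

Section weak_derivatives.
Variable R : realType.
Local Notation mu := (@lebesgue_measure R).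
Local Notation I := (`]0%R, 1%R[%classic : set R).
Implicit Types (f u phi : R -> R) (k x : R).
Implicit Types (U V W : L2 R).

(** A tent T minus the multiple of a fixed tent T0 having the same mass is the
    derivative of a test function, so u is orthogonal to it.  Therefore u - k is
    orthogonal to every tent, where k is the average of u weighted by T0. *)
Lemma du_bois_reymond u : mu.-integrable I (EFin \o u) ->
  (forall phi, C1c01 phi ->
    \int[mu]_(x in `]0, 1[) (u x * phi^`()%classic x) = 0) ->
  exists k, \forall x \ae mu, I x -> u x = k.
Proof.
move=> ui u0.
pose T0 := tent (2^-1 : R) 4^-1; pose m0 := \int[mu]_(t in `]0, 1[) T0 t.
have m0_gt0 : 0 < m0.
  apply: lt_le_trans (tent_mass _ _ _); last 3 first; try lra.
pose k := (\int[mu]_(t in `]0, 1[) (u t * T0 t)) / m0.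
have T0i := tent_integrable (2^-1 : R) 4^-1.
have uT0i : mu.-integrable I (EFin \o (fun x => u x * T0 x)).
  by apply: integrable_tent => //; rewrite invr_ge0.
have ki := integrable_cst k.
exists k.
suff : \forall x \ae mu, I x -> u x - k = 0.
  apply: filterS; first exact: (ae_filter_ringOfSetsType mu).
  by move=> x /[apply] /eqP; rewrite subr_eq0 => /eqP.
apply: fundamental_lemma; first exact: integrableRB.
move=> c r r0 cr0 cr1.
have Ti := tent_integrable c r.
have uTi := integrable_tent c (ltW r0) ui.
pose m := \int[mu]_(t in `]0, 1[) tent c r t.
pose psi t := tent c r t - m / m0 * T0 t.
(* The support of psi lies in the hull of the two supporting intervals
   [c - r, c + r] and [1/4, 3/4]. *)
have [phi phiC phi'] : exists2 phi, C1c01 phi & phi^`()%classic = psi.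
  apply: (@C1c01_primitive _ _ (Num.min (c - r) 4^-1) (Num.max (c + r) (3 / 4))).
  - by rewrite lt_min cr0 /= invr_gt0.
  - by rewrite gt_max cr1 /=; lra.
  - move=> x; apply: cvgB; first exact: continuous_tent.
    by apply: cvgM; [exact: cvg_cst|exact: continuous_tent].
  - move=> x; rewrite negb_and -!ltNge lt_min gt_max => out.
    have [tc t0] : r <= `|x - c| /\ 4^-1 <= `|x - 2^-1|.
      by case/orP: out => /andP[? ?]; split; rewrite ler_normr; apply/orP; lra.
    by rewrite /psi /T0 !tent_out// mulr0 subr0.
  - rewrite RintegralB//; last exact: integrableRZ.
    by rewrite RintegralZl// -/m -/m0 divfK ?subrr// gt_eqF.
have := u0 _ phiC; rewrite phi'.
have -> : \int[mu]_(x in `]0, 1[) (u x * psi x) =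
    \int[mu]_(x in `]0, 1[) (u x * tent c r x) - m / m0 * (k * m0).
  rewrite /k divfK ?gt_eqF// -RintegralZl// -RintegralB//; last first.
    exact: integrableRZ.
  by apply: eq_Rintegral => x _; rewrite /psi; ring.
move=> /eqP; rewrite subr_eq0 => /eqP E.
under eq_Rintegral do rewrite mulrBl.
rewrite RintegralB//; last exact: integrableRZ.
by rewrite RintegralZl// E -/m; field; rewrite gt_eqF.
Qed.

Lemma ae_lebesgue01 (P : R -> Prop) : (\forall x \ae mu, I x -> P x) ->
  \forall x \ae lebesgue01 R, P x.
Proof.
(* The complement of (0,1) is null for the restricted measure. *)
move=> [N [mN N0 sub]]; exists (N `|` ~` I); split.
- by apply: measurableU => //; apply: measurableC.
- rewrite -[LHS]/(mu ((N `|` ~` I) `&` I)) setIUl setICl setU0.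
  by apply: (subset_measure0 (B := N)) => //; exact: measurableI.
- move=> x /= nP; have [Ix|nIx] := pselect (I x); [left|by right].
  by apply: sub => /= /(_ Ix).
Qed.

Lemma L2_eq U V : (\forall x \ae mu, I x -> U x = V x) -> U = V.
Proof.
move=> UV; apply/Lspace_eqP; have := ae_lebesgue01 UV.
apply: filterS; first exact: (ae_filter_ringOfSetsType (lebesgue01 R)).
by move=> x /= ->.
Qed.

Lemma L2_bounded f M : measurable_fun I f -> (forall x, I x -> `|f x| <= M) ->
  exists U : L2 R, \forall x \ae mu, I x -> U x = f x.
Proof.
move=> mf fM; pose g := f \_ I.
have mg : measurable_fun setT g by apply/(measurable_restrictT _ _).1.
have gM x : `|g x| <= Num.max 0 M.
  rewrite /g patchE le_max; case: ifPn => [|_].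
    by rewrite inE => /fM ->; rewrite orbT.
  by rewrite /point /= normr0 lexx.
have gL : g \in Lfun (lebesgue01 R) 2%:E.
  apply/andP; split; rewrite inE//= /finite_norm unlock.
  apply: poweR_lty.
  apply: (@le_lt_trans _ _ (\int[lebesgue01 R]_x (Num.max 0 M `^ 2)%:E)%E).
    apply: ge0_le_integral => //.
    - by move=> x _; exact: poweR_ge0.
    - apply: (@measurableT_comp _ _ _ _ _ _ (fun y : \bar R => (y `^ 2)%E)).
        exact: measurable_poweR.
      by apply: measurableT_comp => //; apply/measurable_EFinP.
    - by move=> x _; rewrite /= lee_fin ge0_ler_powR ?nnegrE// le_max lexx.
  rewrite integral_cst//= /mrestr setTI lebesgue_measure_itv /= lte01.
  by rewrite oppr0 adde0 mule1 ltry.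
exists (Lclass (Lfun_Sub (lee1n 2) gL)).
have := ae_mrestr (Lclass_ae (Lfun_Sub (lee1n 2) gL)).
by apply: filterS => x /= h Ix; rewrite h// /g patchE mem_set.
Qed.

(** Gives the candidate for the weak derivative of the solution as an element
    of L^2(0,1). *)
Lemma L2_prim k f : mu.-integrable I (EFin \o f) ->
  exists U : L2 R, \forall x \ae mu, I x -> U x = k - prim f x.
Proof.
move=> fi; have [M bM] := within_continuous_bounded (prim_continuous fi).
apply: (@L2_bounded _ (`|k| + M)).
  apply: measurable_funB => //.
  by have /integrableP[/measurable_EFinP] := prim_integrable fi.
move=> x Ix; apply: le_trans (ler_normB _ _) _; rewrite lerD2l.
exact: bM.
Qed.

(** By [prim_by_parts] the primitive of V has weak derivative V, so the claim
    amounts to U minus this primitive being constant, which is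
    [du_bois_reymond]. *)
Lemma weak_derivativeP U V : is_weak_derivative U V <->
  exists k, \forall x \ae mu, I x -> U x = k + prim V x.
Proof.
have Ui := L2_integrable01 U; have Vi := L2_integrable01 V.
have pVi := prim_integrable Vi.
split=> [UV|[k Uk] phi phiC].
  have [k kP] : exists k, \forall x \ae mu, I x -> U x - prim V x = k.
    apply: du_bois_reymond; first exact: integrableRB.
    move=> phi phiC; under eq_Rintegral do rewrite mulrBl.
    rewrite RintegralB//; [|exact: integrable_C1c01..].
    by rewrite prim_by_parts// UV// subrr.
  exists k; apply: filterS kP; first exact: (ae_filter_ringOfSetsType mu).
  by move=> x /[apply] <-; rewrite subrK.
have phii := C1c01_deriv_integrable phiC.
have pphii := integrable_C1c01 pVi phiC.
have -> : - (\int[mu]_(x in `]0, 1[) (V x * phi x)) =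
    \int[mu]_(x in `]0, 1[)
      (k * phi^`()%classic x + prim V x * phi^`()%classic x).
  rewrite RintegralD//; last exact: integrableRZ.
  by rewrite RintegralZl// C1c01_integral_deriv// mulr0 add0r prim_by_parts.
apply: Rintegral_ae_eq; first exact: integrable_C1c01.
  have := integrableRB (integrableRZ k phii) (integrableRZ (-1) pphii).
  by apply: eq_integrable => // x _; rewrite /= mulN1r opprK.
apply: filterS Uk; first exact: (ae_filter_ringOfSetsType mu).
by move=> x /[apply] ->; rewrite mulrDl.
Qed.

(** Two weak derivatives of the same function have primitives differing by a
    constant almost everywhere, hence everywhere by continuity; at 0 this
    constant is seen to be zero, and then so is the difference of the
    derivatives. *)
Lemma weak_derivative_unique U V W :
  is_weak_derivative U V -> is_weak_derivative U W -> V = W.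
Proof.
have Vi := L2_integrable01 V; have Wi := L2_integrable01 W.
move=> /weak_derivativeP[k kP] /weak_derivativeP[l lP].
have VW x : 0 <= x <= 1 -> prim (fun t => V t - W t) x = l - k.
  apply: (@ae_eq_within_continuous _ _ (cst (l - k))).
  - exact/prim_continuous/integrableRB.
  - by apply: continuous_subspaceT => y; exact: cvg_cst.
  apply: filterS2 kP lP; first exact: (ae_filter_ringOfSetsType mu).
  move=> y Uk Ul Iy; move: (Iy); rewrite /= in_itv /= => /andP[y0 y1].
  rewrite primB// ?(ltW y0) ?(ltW y1)//=.
  by have := Uk Iy; rewrite Ul// => E; lra.
have lk : l - k = 0 by rewrite -(VW 0) ?lexx ?ler01// prim0.
apply: L2_eq; have := @prim_eq0 _ (fun t => V t - W t) (integrableRB Vi Wi).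
move=> /(_ (fun x x01 => etrans (VW x x01) lk)).
apply: filterS; first exact: (ae_filter_ringOfSetsType mu).
by move=> x /[apply] /eqP; rewrite subr_eq0 => /eqP.
Qed.

Lemma wderivE U V : is_weak_derivative U V -> wderiv U = V.
Proof.
move=> UV; apply: (weak_derivative_unique _ UV).
by apply: (@xgetPex _ 0 [set V | is_weak_derivative U V]); exists V.
Qed.

Lemma wderivP U : H1 U -> is_weak_derivative U (wderiv U).
Proof. by move=> [V UV]; rewrite (wderivE UV). Qed.

End weak_derivatives.

(** * The antiperiodic problem *)

Section antiperiodic_problem.
Variable R : realType.
Local Notation mu := (@lebesgue_measure R).
Local Notation I := (`]0%R, 1%R[%classic : set R).
Implicit Types (k x : R).

(** Exchanging the integrals, the weight of f(y) is the length of [y, x]. *)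
Lemma prim_prim f x : mu.-integrable I (EFin \o f) -> 0 <= x <= 1 ->
  prim (prim f) x = \int[mu]_(y in `]0, 1[) (Num.max 0 (x - y) * f y).
Proof.
move=> fi x01; have /andP[x0 x1] := x01.
have onei := integrable_cst (1 : R).
rewrite prim_cond//; last exact: prim_integrable.
under eq_Rintegral do rewrite mulrC.
rewrite prim_swap//; last first.
  have mb : measurable_fun setT (fun t : R => t <= x).
    exact: measurable_fun_ler.
  have := integrable_cond mb onei.
  by apply: eq_integrable => // t _; rewrite /= mulr1.
apply: eq_Rintegral => y; rewrite inE /= in_itv /= => /andP[y0 y1].
rewrite mulrC; congr (_ * _).
transitivity (\int[mu]_(t in `[y, x]) (1 : R)).
  rewrite (_ : `[y, x]%classic = `[y, 1] `&` [set t | t <= x]).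
    rewrite Rintegral_mkcondr; apply: eq_Rintegral => t _; rewrite patchE.
    case: ifPn; first by rewrite inE /= => ->.
    by rewrite notin_setE /= => /negP/negbTE ->.
  apply/seteqP; split => t /=; rewrite !in_itv /=.
    by move=> /andP[-> tx]; rewrite tx (le_trans tx).
  by move=> [/andP[-> _] ->].
rewrite Rintegral_cst//= mul1r lebesgue_measure_itv /= lte_fin.
case: ltP => xy; first by rewrite -EFinB /= max_r// subr_ge0 ltW.
by rewrite max_l// subr_le0.
Qed.

Definition mean f := \int[mu]_(y in `]0, 1[) f y.
Definition moment f := \int[mu]_(y in `]0, 1[) (y * f y).

Lemma integrable_id_mul f : mu.-integrable I (EFin \o f) ->
  mu.-integrable I (EFin \o (fun y => y * f y)).
Proof.
move=> fi.
have : mu.-integrable I (EFin \o (fun y => f y * y)).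
  apply: (@integrable_mulr _ _ _ 1) => // y.
  by rewrite /= in_itv /= => /andP[y0 y1]; rewrite ger0_norm ltW.
by apply: eq_integrable => // y _; rewrite /= mulrC.
Qed.

(** Uses |x - y| = 2 max(0, x - y) - (x - y), where the first term gives the
    double primitive of f and the second is affine in x. *)
Lemma Kfun_prim (f : L2 R) x : 0 <= x <= 1 ->
  Kfun f x = prim (fun t => mean f / 2 - prim f t) x - moment f / 2.
Proof.
move=> x01; have /andP[x0 x1] := x01.
have fi := L2_integrable01 f.
have ki := integrable_cst (mean f / 2).
rewrite primB//; last exact: prim_integrable.
rewrite prim_cst// prim_prim//.
have yfi := integrable_id_mul fi.
have mfi : mu.-integrable I (EFin \o (fun y => Num.max 0 (x - y) * f y)).
  have : mu.-integrable I (EFin \o (fun y => f y * Num.max 0 (x - y))).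
    apply: (@integrable_mulr _ _ _ 1) => // [|y].
      apply: measurable_funTS; apply: measurable_maxr => //.
      exact: measurable_funB.
    rewrite /= in_itv /= => /andP[y0 y1].
    by rewrite ger0_norm ?le_max ?lexx// ge_max ler01 /=; lra.
  by apply: eq_integrable => // y _; rewrite /= mulrC.
rewrite /Kfun (_ : \int[mu]_(y in _) _ =
  \int[mu]_(y in `]0, 1[)
    (2 * (Num.max 0 (x - y) * f y) - (x * f y - y * f y))); last first.
  apply: eq_Rintegral => y _; rewrite mulrA -mulrBl -mulrBl; congr (_ * _).
  by rewrite maxr_absE add0r sub0r normrN; field.
rewrite !RintegralB//; [|exact: integrableRZ..|]; last first.
  exact: integrableRB (integrableRZ _ _) _.
by rewrite !RintegralZl// -/(mean f) -/(moment f); field.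
Qed.

Lemma Kfun0 (f : L2 R) : Kfun f 0 = - moment f / 2.
Proof. by rewrite Kfun_prim ?lexx ?ler01// prim0 sub0r mulNr. Qed.

Lemma Kfun1 (f : L2 R) : Kfun f 1 = (moment f - mean f) / 2.
Proof.
have fi := L2_integrable01 f.
rewrite /Kfun (_ : \int[mu]_(y in _) _ =
    \int[mu]_(y in `]0, 1[) (f y - y * f y)).
  rewrite RintegralB//; last exact: integrable_id_mul.
  by rewrite -/(mean f) -/(moment f); field.
apply: eq_Rintegral => y; rewrite inE /= in_itv /= => /andP[y0 y1].
by rewrite ger0_norm ?mulrBl ?mul1r// subr_ge0 ltW.
Qed.

(** The equation determines u up to the affine function c0 + c1 x, and the
    boundary conditions determine c0 and c1.  Conversely the given function
    visibly has the required primitives and boundary values. *)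
Lemma antiperiodic_solution (u f : L2 R) :
  (op_dom antiperiodic_op u /\ antiperiodic_op u = f) <->
  \forall x \ae mu, I x -> u x = Kfun f x + 4^-1 * mean f.
Proof.
have fi := L2_integrable01 f.
have pfi := prim_integrable fi.
have csti := @integrable_cst R.
have ccst (k : R) : {within `[0%R, 1%R], continuous (fun _ : R => k : R)}.
  by apply: continuous_subspaceT => y; exact: cvg_cst.
have inI x : I x -> 0 <= x <= 1.
  by rewrite /= in_itv /= => /andP[? ?]; apply/andP; split; exact: ltW.
have prim1 : prim f 1 = mean f.
  rewrite prim_cond ?ler01 ?lexx//; apply: eq_Rintegral => y.
  by rewrite inE /= in_itv /= => /andP[_ /ltW ->]; rewrite mul1r.
split=> [[[[uH1 wH1] [U0 [U1 [[cU0 uU0] [cU1 wU1] bc0 bc1]]]] Auf]|uE].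
(* Integrating twice, then solving for the constants. *)
- set w := wderiv u in wH1 wU1 Auf.
  have /weak_derivativeP[c0 uE] := wderivP uH1.
  have /weak_derivativeP[c1 wE] := wderivP wH1.
  rewrite -/w in uE.
  have zE : \forall x \ae mu, I x -> wderiv w x = 0 - f x.
    have -> : wderiv w = - f by rewrite -Auf /= opprK.
    have := ae_mrestr (LspaceNE f).
    by apply: filterS => x h Ix; rewrite sub0r; exact: h.
  have zi := L2_integrable01 (wderiv w).
  have pz x : 0 <= x <= 1 -> prim (wderiv w) x = - prim f x.
    move=> x01; rewrite (eq_prim zi (integrableRB (csti 0) fi) zE x01).
    by rewrite primB// prim_cst ?mul0r ?sub0r//; case/andP: x01.
  have wE' : \forall x \ae mu, I x -> w x = c1 - prim f x.
    apply: filterS wE; first exact: (ae_filter_ringOfSetsType mu).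
    by move=> x wx Ix; rewrite wx// pz//; exact: inI.
  have U1E x : 0 <= x <= 1 -> U1 x = c1 - prim f x.
    apply: (@ae_eq_within_continuous _ U1 (fun x => c1 - prim f x)) => //.
      exact: (within_continuousB (ccst _) (prim_continuous fi)).
    apply: filterS2 wU1 wE'; first exact: (ae_filter_ringOfSetsType mu).
    by move=> y w1 w2 Iy; rewrite -w1// w2.
  have c1E : c1 = mean f / 2.
    by move: bc1; rewrite !U1E ?ler01 ?lexx// prim0 prim1; lra.
  pose w0 t := mean f / 2 - prim f t.
  have w0i : mu.-integrable I (EFin \o w0) by exact: integrableRB.
  have uE' : \forall x \ae mu, I x -> u x = c0 + prim w0 x.
    apply: filterS uE; first exact: (ae_filter_ringOfSetsType mu).
    move=> x ux Ix; rewrite ux//; congr (_ + _); apply: eq_prim => //.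
    - exact: L2_integrable01.
    - by rewrite /w0 -c1E.
    - exact: inI.
  have U0E x : 0 <= x <= 1 -> U0 x = c0 + prim w0 x.
    apply: (@ae_eq_within_continuous _ U0 (fun x => c0 + prim w0 x)) => //.
      exact: (within_continuousD (ccst _) (prim_continuous w0i)).
    apply: filterS2 uU0 uE'; first exact: (ae_filter_ringOfSetsType mu).
    by move=> y w1 w2 Iy; rewrite -w1// w2.
  have c0E : c0 = mean f / 4 - moment f / 2.
    move: bc0; rewrite !U0E ?ler01 ?lexx// prim0.
    by have := Kfun1 f; rewrite Kfun_prim ?ler01 ?lexx//; lra.
  apply: filterS uE'; first exact: (ae_filter_ringOfSetsType mu).
  by move=> x ux Ix; rewrite ux// Kfun_prim ?inI// c0E; field.
(* The derivatives of the solution are m / 2 - F and - f. *)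
- have [w wE] := L2_prim (mean f / 2) fi.
  have uw : is_weak_derivative u w.
    apply/weak_derivativeP; exists (mean f / 4 - moment f / 2).
    apply: filterS uE; first exact: (ae_filter_ringOfSetsType mu).
    move=> x ux Ix; rewrite ux// Kfun_prim ?inI//.
    rewrite (@eq_prim _ w (fun t => mean f / 2 - prim f t)) ?inI//; first by field.
      exact: L2_integrable01.
    exact: integrableRB.
  have Nf : \forall x \ae mu, I x -> (- f : L2 R) x = 0 - f x.
    have := ae_mrestr (LspaceNE f).
    by apply: filterS => x h Ix; rewrite sub0r; exact: h.
  have wf : is_weak_derivative w (- f).
    apply/weak_derivativeP; exists (mean f / 2).
    apply: filterS wE; first exact: (ae_filter_ringOfSetsType mu).
    move=> x wx Ix; rewrite wx// (@eq_prim _ (- f : L2 R) (fun t => 0 - f t)) ?inI//.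
    - by rewrite primB ?inI// prim_cst ?mul0r ?sub0r//; case/andP: (inI _ Ix).
    - exact: L2_integrable01.
    - exact: integrableRB.
  split; last by rewrite /= (wderivE uw) (wderivE wf) opprK.
  split; first by split; [exists w|rewrite (wderivE uw); exists (- f)].
  exists (fun x => Kfun f x + 4^-1 * mean f), (fun x => mean f / 2 - prim f x).
  split.
  - split=> //; apply: continuous_subspaceT => x.
    by apply: cvgD; [exact: continuous_Kfun|exact: cvg_cst].
  - rewrite (wderivE uw); split=> //.
    exact: (within_continuousB (ccst _) (prim_continuous fi)).
  - by rewrite Kfun0 Kfun1; field.
  - by rewrite prim0 prim1; field.
Qed.

End antiperiodic_problem.

(** * The Green's operator *)

Section green_operator.
Variable R : realType.
Local Notation mu := (@lebesgue_measure R).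
Local Notation I := (`]0%R, 1%R[%classic : set R).
Implicit Types (x : R).

Lemma u1_ae : \forall x \ae mu, I x -> (u1 : L2 R) x = 1.
Proof.
have := ae_mrestr (Lclass_ae (Lfun_Sub (lee1n 2) (@cst1_Lfun R))).
by apply: filterS => x h Ix; exact: h.
Qed.

Lemma inner_cst (f g : L2 R) k : (\forall x \ae mu, I x -> g x = k) ->
  inner f g = k * mean f.
Proof.
move=> gk; have fi := L2_integrable01 f.
have kfi := integrableRZ k fi.
have E : \forall x \ae mu, I x -> f x * g x = k * f x.
  apply: filterS gk; first exact: (ae_filter_ringOfSetsType mu).
  by move=> x /[apply] ->; rewrite mulrC.
have mfg : measurable_fun setT (fun x => f x * g x).
  by apply: measurable_funM; exact: measurable_L2.
rewrite -RintegralZl//; apply: Rintegral_ae_eq => //.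
apply/integrableP; split; first by apply/measurable_EFinP; exact: measurable_funTS.
have /integrableP[mkf] := kfi; congr (_ < _)%E; apply: ae_eq_integral => //.
- exact: measurableT_comp.
- by apply: measurableT_comp => //; apply/measurable_EFinP; exact: measurable_funTS.
apply: filterS E; first exact: (ae_filter_ringOfSetsType mu).
by move=> x h Ix; rewrite /= h.
Qed.

Lemma inner_u1 (f : L2 R) : inner f u1 = mean f.
Proof. by rewrite (inner_cst _ u1_ae) mul1r. Qed.

Lemma mean_is_linear a (f g : L2 R) :
  mean (a *: f + g : L2 R) = a * mean f + mean g.
Proof.
have fi := L2_integrable01 f; have gi := L2_integrable01 g.
rewrite /mean -RintegralZl// -RintegralD//; last exact: integrableRZ.
have gafi := integrableRB gi (integrableRZ (- a) fi).
apply: Rintegral_ae_eq; first exact: L2_integrable01.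
  by move: gafi; apply: eq_integrable => // x _; rewrite /= mulNr opprK addrC.
have h1 := ae_mrestr (LspaceDE (a *: f) g); have h2 := ae_mrestr (LspaceZE a f).
by apply: filterS2 h1 h2 => x h1 h2 Ix; rewrite h1// h2.
Qed.

Definition mean_op (f : L2 R) : L2 R := (- 4^-1 * mean f) *: u1.

Lemma mean_op_is_linear : linear mean_op.
Proof.
move=> a f g; rewrite /mean_op mean_is_linear scalerA -scalerDl.
by congr (_ *: _); ring.
Qed.

HB.instance Definition _ :=
  GRing.isLinear.Build R (L2 R) (L2 R) _ mean_op mean_op_is_linear.

Definition green : {linear L2 R -> L2 R} := @K R \- mean_op.

Lemma greenE (f : L2 R) :
  \forall x \ae mu, I x -> green f x = Kfun f x + 4^-1 * mean f.
Proof.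
have h1 := ae_mrestr (LspaceDE (K f) (- mean_op f)).
have h2 := ae_mrestr (LspaceNE (mean_op f)).
have h3 := ae_mrestr (LspaceZE (- 4^-1 * mean f) (u1 : L2 R)).
have h4 := ae_mrestr (K_ae f).
have h12 : \forall x \ae mu, I x ->
    (K f - mean_op f : L2 R) x = K f x - mean_op f x.
  by apply: filterS2 h1 h2 => x h1 h2 Ix; rewrite h1// h2.
have h34 : \forall x \ae mu, I x -> mean_op f x = - 4^-1 * mean f.
  by apply: filterS2 h3 u1_ae => x h3 h5 Ix; rewrite [LHS]h3// h5// mulr1.
have hK : \forall x \ae mu, I x -> K f x = Kfun f x.
  by apply: filterS h4 => x h Ix; exact: h.
apply: filterS3 h12 h34 hK; first exact: (ae_filter_ringOfSetsType mu).
by move=> x h12 h34 hK Ix; rewrite [LHS]h12// h34// hK// mulNr opprK.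
Qed.

(** The case f = 0 of [antiperiodic_solution]. *)
Lemma antiperiodic_ker (u : L2 R) : op_ker antiperiodic_op u <-> u = 0.
Proof.
have e : op_ker antiperiodic_op u <-> u = green 0.
  rewrite /op_ker /=; split=> [/antiperiodic_solution uE|->].
    apply: L2_eq; apply: filterS2 uE (greenE 0).
      exact: (ae_filter_ringOfSetsType mu).
    by move=> x h1 h2 Ix; rewrite h1// h2.
  by apply/antiperiodic_solution/greenE.
by rewrite linear0 in e.
Qed.

End green_operator.

Arguments green {R}.

Section green_operator_properties.
Variable R : realType.
Local Notation mu := (@lebesgue_measure R).
Local Notation I := (`]0%R, 1%R[%classic : set R).
Implicit Types (c x : R).

Lemma lebesgue01_setT : lebesgue01 R setT = 1%E.
Proof.
rewrite -[LHS]/(mu (setT `&` I)) setTI lebesgue_measure_itv /= lte01.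
by rewrite oppr0 adde0.
Qed.

Lemma Lnorm_bounded_ae (U : L2 R) (c : R) : 0 <= c ->
  (\forall x \ae mu, I x -> `|U x| <= c) ->
  ('N[lebesgue01 R]_2%:E[EFin \o U] <= c%:E)%E.
Proof.
move=> c0 Uc; have mU := measurable_L2 U.
have -> : c%:E = ((\int[lebesgue01 R]_x ((c `^ 2)%:E)) `^ 2^-1)%E.
  rewrite integral_cst//= [lebesgue01 R setT]lebesgue01_setT mule1 poweR_EFin.
  by rewrite -powRrM mulfV// powRr1.
rewrite unlock /Lnorm; apply: gt0_ler_poweR.
- by rewrite invr_ge0.
- rewrite in_itv /= leey andbT; apply: integral_ge0 => x _.
  by rewrite lee_fin powR_ge0.
- rewrite in_itv /= leey andbT; apply: integral_ge0 => x _.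
  by rewrite lee_fin powR_ge0.
apply: ae_ge0_le_integral => //.
- by move=> x _; exact: poweR_ge0.
- apply: (@measurableT_comp _ _ _ _ _ _ (fun y : \bar R => (y `^ 2)%E)).
    exact: measurable_poweR.
  by apply: measurableT_comp => //; apply/measurable_EFinP.
- by move=> x _; rewrite lee_fin; exact: powR_ge0.
have := ae_lebesgue01 Uc.
apply: filterS; first exact: (ae_filter_ringOfSetsType (lebesgue01 R)).
move=> x Uxc _.
by rewrite /= lee_fin ge0_ler_powR// nnegrE.
Qed.

(** Hoelder's inequality against the constant 1, as (0,1) has measure 1. *)
Lemma L1_le_L2 (U : L2 R) :
  ((\int[mu]_(x in `]0, 1[) `|U x|)%:E <= 'N[lebesgue01 R]_2%:E[EFin \o U])%E.
Proof.
have mU := measurable_L2 U.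
have -> : (\int[mu]_(x in `]0, 1[) `|U x|)%:E = ('N[lebesgue01 R]_1[EFin \o U])%E.
  rewrite Lnorm1 /lebesgue01 ge0_integral_mrestr//; last first.
    by apply: measurableT_comp => //; exact/measurable_EFinP.
  rewrite /Rintegral fineK//.
  by apply: integrable_fin_num => //; exact: integrable_norm (L2_integrable01 U).
have := @hoelder _ _ _ (lebesgue01 R) U (cst 1) 2 2 mU (measurable_cst _).
have -> : ('N[lebesgue01 R]_2%:E[EFin \o cst 1%R] = 1)%E.
  rewrite (_ : EFin \o cst 1 = cst 1%E)// Lnorm_cst1.
  by rewrite lebesgue01_setT poweR1r.
rewrite mule1 (_ : (U \* cst 1)%R = U); last by apply/funext => x; rewrite /= mulr1.
by apply=> //; lra.
Qed.

Lemma green_bounded : bounded_op (@green R).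
Proof.
(* |K f| and |m| are both at most the L^1 norm of f, and 5/4 = 1 + 1/4. *)
exists (5 / 4) => f; have fi := L2_integrable01 f.
set L := \int[mu]_(x in `]0, 1[) `|f x|.
have L0 : 0 <= L by exact: Rintegral_ge0.
apply: (@le_trans _ _ (5 / 4 * L)%:E); last first.
  by rewrite EFinM lee_wpmul2l ?lee_fin ?divr_ge0//; exact: L1_le_L2.
apply: Lnorm_bounded_ae; first by rewrite mulr_ge0// divr_ge0.
apply: filterS (greenE f); first exact: (ae_filter_ringOfSetsType mu).
move=> x gx Ix; rewrite gx//.
have K1 : `|Kfun f x| <= L by exact: Kfun_bound.
have m1 : `|mean f| <= L by exact: le_normr_Rintegral.
apply: le_trans (ler_normD _ _) _.
by rewrite (normrM 4^-1) (@ger0_norm _ 4^-1) ?invr_ge0//; lra.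
Qed.

Lemma green_is_green : is_green_operator antiperiodic_op (@green R).
Proof.
split; first exact: green_bounded.
exists (fun=> 0) => [f|f].
  split; first exact/antiperiodic_ker.
  move=> g /antiperiodic_ker ->; rewrite subr0.
  have g0 : \forall x \ae mu, I x -> (0 : L2 R) x = 0.
    have := ae_mrestr (Lspace0E (lebesgue01 R) (lee1n 2)).
    by apply: filterS => x h Ix; exact: h.
  by rewrite (inner_cst _ g0) mul0r.
have [dom Af] := (antiperiodic_solution (green f) f).2 (greenE f).
by split; [exact: dom|rewrite subr0|exact: linear0|].
Qed.

(** The kernel is trivial, which forces the projection to vanish; the image of
    f is then the solution of the boundary value problem. *)
Lemma green_unique (KG : {linear L2 R -> L2 R}) :
  is_green_operator antiperiodic_op KG -> forall f : L2 R, KG f = green f.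
Proof.
move=> [_ [P Pproj KGP]] f.
have P0 : P f = 0 by apply/antiperiodic_ker; case: (Pproj f).
have [dom Af _ _] := KGP f; rewrite P0 subr0 in Af.
have := (antiperiodic_solution (KG f) f).1 (conj dom Af) => h.
apply: L2_eq; apply: filterS2 h (greenE f).
  exact: (ae_filter_ringOfSetsType mu).
by move=> x h1 h2 Ix; rewrite h1// h2.
Qed.

Lemma mean_u1 : mean (u1 : L2 R) = 1.
Proof.
rewrite /mean (Rintegral_ae_eq (L2_integrable01 _) _ (@u1_ae R)).
  by rewrite Rintegral_cst//= lebesgue_measure_itv /= lte01 oppr0 adde0 mul1r.
exact: integrable_cst.
Qed.

Lemma mean_scale_u1 (c : R) : mean (c *: u1 : L2 R) = c.
Proof.
have := mean_is_linear (c - 1) u1 u1.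
by rewrite mean_u1 scalerBl scale1r subrK mulr1 subrK.
Qed.

End green_operator_properties.

(** * The theorem *)

Theorem mainTheorem7 (R : realType) :
  (exists KG : {linear L2 R -> L2 R}, is_green_operator antiperiodic_op KG) /\
  forall KG : {linear L2 R -> L2 R}, is_green_operator antiperiodic_op KG ->
    has_rank (@K R \- KG) 1 /\
    forall f : L2 R,
      (@K R \- KG) f = (- 4^-1 * inner f u1) *: u1 /\
      \forall x \ae @lebesgue_measure R, `]0, 1[%classic x ->
        (@K R \- KG) f x = - 4^-1 * \int[lebesgue_measure]_(y in `]0, 1[) f y.
Proof.
split; first by exists (@green R); exact: green_is_green.
move=> KG /green_unique KGE.
have TE f : (@K R \- KG) f = (- 4^-1 * mean f) *: u1.
  by rewrite /= KGE /green /= opprB addrC subrK.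
split; last first.
  move=> f; rewrite inner_u1 TE; split=> //.
  have Z := ae_mrestr (LspaceZE (- 4^-1 * mean f) (u1 : L2 R)).
  apply: filterS2 Z (@u1_ae R) => x h u1x Ix.
  by rewrite [LHS]h// u1x// mulr1.
(* Applying the mean to c u1 recovers c: this gives independence. *)
exists (fun=> u1) => [c|].
  rewrite big_ord1 => /(congr1 (fun u : L2 R => mean u)).
  rewrite mean_scale_u1 -(scale0r u1) mean_scale_u1 => c0 i.
  by rewrite ord1.
apply/seteqP; split=> u /=.
  move=> [f _ <-]; exists (fun=> - 4^-1 * mean f) => //.
  by rewrite big_ord1 -TE.
move=> [c _ <-]; rewrite big_ord1.
(* The perturbation multiplies u1 by - 1/4. *)
exists ((- 4 * c ord0) *: u1) => //.
by apply: (etrans (TE _)); rewrite mean_scale_u1; congr (_ *: _); field.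
Qed.
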